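(* Let $s,r \geq 2$ be integers. Then \[ \operatorname{BR}^2(\diamond_s,\vee_r) \leq \operatorname{BR}^2(\wedge_{s+r},\vee_r) \leq \left\lceil\log_{3/2}(2r+s-1) \right\rceil. \]
   Context: 2-uniform pographs: $\vee_r$ (the $r$-cup) has poset $\{x,y_1,\dots,y_r\}$ with $x\le y_i$ and edges $xy_i$; $\wedge_r$ (the $r$-cap) has poset $\{y,x_1,\dots,x_r\}$ with $x_i\le y$ and edges $x_iy$; $\diamond_s$ (the $s$-diamond) has poset $\{x,y_1,\dots,y_s,z\}$ with $x\le y_i\le z$ and edges $xy_i,y_iz$. Given a coloring of the comparable pairs of a poset $Q$, a copy of $H$ in color $i$ is an injection $f:V(H)\to Q$ with $f(x)\le f(y)$ whenever $x\le y$ such that every edge of $H$ is mapped to a pair of color $i$. $\operatorname{BR}^2(G_1,G_2)$ is the least $N$ such that every 2-coloring of the comparable pairs of the Boolean lattice $B_N$ (subsets of $[N]$) contains a copy of $G_1$ in color 1 or a copy of $G_2$ in color 2. *)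

(* Defs.v *)
From HB Require Import structures.
From mathcomp Require Import all_boot all_order.

Set Implicit Arguments.
Unset Strict Implicit.
Unset Printing Implicit Defensive.

Import Order.TTheory Order.DefaultSetSubsetOrder.

(* A 2-uniform pograph: a finite poset together with a set of two-element
   chains. An edge is stored as the ordered pair (lower end, upper end). *)
Record pograph := Pograph {
  pg_disp : Order.disp_t;
  vertex : finPOrderType pg_disp;
  edge : rel vertex;
  edge_lt : forall u v : vertex, edge u v -> (u < v)%O }.

Fact pograph_display : Order.disp_t. Proof. exact: (Order.Disp tt tt). Qed.

Section Cup.
Variable r : nat.

Inductive cup_vertex := CupX | CupY of 'I_r.

Definition cup_code (u : cup_vertex) : option 'I_r :=
  if u is CupY i then Some i else None.
Definition cup_decode (o : option 'I_r) : cup_vertex :=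
  if o is Some i then CupY i else CupX.
Lemma cup_codeK : cancel cup_code cup_decode. Proof. by case. Qed.

HB.instance Definition _ := Finite.copy cup_vertex (can_type cup_codeK).

Definition cup_le : rel cup_vertex := fun u v =>
  match u, v with
  | CupX, _ => true
  | CupY i, CupY j => i == j
  | CupY _, CupX => false
  end.

Lemma cup_le_refl : reflexive cup_le. Proof. by case=> /=. Qed.
Lemma cup_le_anti : antisymmetric cup_le.
Proof. by move=> [|i] [|j] //= /andP[/eqP->]. Qed.
Lemma cup_le_trans : transitive cup_le.
Proof. by move=> [|i] [|j] [|k] //= /eqP->. Qed.

HB.instance Definition _ := Order.Le_isPOrder.Build pograph_display cup_vertex
  cup_le_refl cup_le_anti cup_le_trans.

Definition cup_edge : rel cup_vertex := fun u v =>
  match u, v with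
  | CupX, CupY _ => true
  | _, _ => false
  end.

Lemma cup_edge_lt (u v : cup_vertex) : cup_edge u v -> (u < v)%O.
Proof. by case: u v => [|i] [|j] //= _; rewrite lt_neqAle. Qed.

Definition cup : pograph := Pograph cup_edge_lt.
End Cup.

Section Cap.
Variable r : nat.

Inductive cap_vertex := CapX of 'I_r | CapY.

Definition cap_code (u : cap_vertex) : option 'I_r :=
  if u is CapX i then Some i else None.
Definition cap_decode (o : option 'I_r) : cap_vertex :=
  if o is Some i then CapX i else CapY.
Lemma cap_codeK : cancel cap_code cap_decode. Proof. by case. Qed.

HB.instance Definition _ := Finite.copy cap_vertex (can_type cap_codeK).

Definition cap_le : rel cap_vertex := fun u v =>
  match u, v with
  | _, CapY => true
  | CapX i, CapX j => i == j
  | CapY, CapX _ => false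
  end.

Lemma cap_le_refl : reflexive cap_le. Proof. by case=> /=. Qed.
Lemma cap_le_anti : antisymmetric cap_le.
Proof. by move=> [i|] [j|] //= /andP[/eqP->]. Qed.
Lemma cap_le_trans : transitive cap_le.
Proof. by move=> [i|] [j|] [k|] //= /eqP->. Qed.

HB.instance Definition _ := Order.Le_isPOrder.Build pograph_display cap_vertex
  cap_le_refl cap_le_anti cap_le_trans.

Definition cap_edge : rel cap_vertex := fun u v =>
  match u, v with
  | CapX _, CapY => true
  | _, _ => false
  end.

Lemma cap_edge_lt (u v : cap_vertex) : cap_edge u v -> (u < v)%O.
Proof. by case: u v => [i|] [j|] //= _; rewrite lt_neqAle. Qed.

Definition cap : pograph := Pograph cap_edge_lt.
End Cap.

Section Diamond.
Variable s : nat.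

Inductive diamond_vertex := DiaX | DiaY of 'I_s | DiaZ.

Definition diamond_code (u : diamond_vertex) : option (option 'I_s) :=
  match u with
  | DiaX => None
  | DiaY i => Some (Some i)
  | DiaZ => Some None
  end.
Definition diamond_decode (o : option (option 'I_s)) : diamond_vertex :=
  match o with
  | None => DiaX
  | Some (Some i) => DiaY i
  | Some None => DiaZ
  end.
Lemma diamond_codeK : cancel diamond_code diamond_decode. Proof. by case. Qed.

HB.instance Definition _ := Finite.copy diamond_vertex (can_type diamond_codeK).

Definition diamond_le : rel diamond_vertex := fun u v =>
  match u, v with
  | DiaX, _ => true
  | _, DiaZ => true
  | DiaY i, DiaY j => i == j
  | _, _ => false
  end.

Lemma diamond_le_refl : reflexive diamond_le. Proof. by case=> /=. Qed.
Lemma diamond_le_anti : antisymmetric diamond_le.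
Proof. by move=> [|i|] [|j|] //= /andP[/eqP->]. Qed.
Lemma diamond_le_trans : transitive diamond_le.
Proof. by move=> [|i|] [|j|] [|k|] //= /eqP->. Qed.

HB.instance Definition _ :=
  Order.Le_isPOrder.Build pograph_display diamond_vertex
    diamond_le_refl diamond_le_anti diamond_le_trans.

Definition diamond_edge : rel diamond_vertex := fun u v =>
  match u, v with
  | DiaX, DiaY _ => true
  | DiaY _, DiaZ => true
  | _, _ => false
  end.

Lemma diamond_edge_lt (u v : diamond_vertex) : diamond_edge u v -> (u < v)%O.
Proof. by case: u v => [|i|] [|j|] //= _; rewrite lt_neqAle. Qed.

Definition diamond : pograph := Pograph diamond_edge_lt.
End Diamond.

Definition color1 : 'I_2 := ord0.
Definition color2 : 'I_2 := ord_max.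

(* [c a b] is the colour of the comparable pair a < b. The values of [c] at
   other pairs are never inspected: in [is_copy], [u < v] for every edge, so
   injectivity and monotonicity of [f] give [f u < f v]. *)
Definition coloring (d : Order.disp_t) (Q : porderType d) := Q -> Q -> 'I_2.

Definition is_copy (d : Order.disp_t) (Q : porderType d) (c : coloring Q)
    (H : pograph) (i : 'I_2) (f : vertex H -> Q) : Prop :=
  [/\ injective f,
      (forall u v : vertex H, (u <= v)%O -> (f u <= f v)%O) &
      forall u v : vertex H, edge u v -> c (f u) (f v) = i].

Definition has_copy (d : Order.disp_t) (Q : porderType d) (c : coloring Q)
    (H : pograph) (i : 'I_2) : Prop :=
  exists f : vertex H -> Q, is_copy c i f.

(* Ordered by inclusion, through [Order.DefaultSetSubsetOrder]. *)
Definition boolean_lattice (N : nat) : finPOrderType _ := {set 'I_N}.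

Definition BR2_arrow (G1 G2 : pograph) (N : nat) : Prop :=
  forall c : coloring (boolean_lattice N),
    has_copy c G1 color1 \/ has_copy c G2 color2.

(* [is_BR2 G1 G2 N]: the Ramsey number BR^2(G1, G2) exists and equals N. *)
Definition is_BR2 (G1 G2 : pograph) (N : nat) : Prop :=
  BR2_arrow G1 G2 N /\ forall M : nat, BR2_arrow G1 G2 M -> (N <= M)%N.

(* Main.v *)
(** Double counting in the Boolean lattice: if no point is the top of a colour-1
    cap with [k] legs nor the bottom of a colour-2 cup with [r] legs, there are
    at most [2^N * (k - 1)] pairs of colour 1 and, as the full set lies below
    nothing, at most [(2^N - 1) * (r - 1)] pairs of colour 2. But there are
    [3^N - 2^N] comparable pairs. Conversely, from a colour-1 cap with [s + r]
    legs, the empty set as bottom yields a diamond: at most one leg is the empty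
    set itself, and fewer than [r] are joined to it in colour 2. *)
Require Import Defs.
From mathcomp Require Import all_boot all_order all_algebra.
From mathcomp Require Import all_classical all_reals all_analysis.

Import Order.TTheory GRing.Theory Num.Theory.
Local Open Scope ring_scope.

Definition up_nbr {d} {Q : finPOrderType d} (c : coloring Q) (i : 'I_2) (x : Q) :=
  [pred y : Q | (x < y)%O && (c x y == i)].

Definition down_nbr {d} {Q : finPOrderType d} (c : coloring Q) (i : 'I_2) (y : Q) :=
  [pred x : Q | (x < y)%O && (c x y == i)].

Lemma inj_of_card {T : finType} {A : {pred T}} {n : nat} (hn : (n <= #|A|)%N) :
  exists2 f : 'I_n -> T, injective f & forall j, f j \in A.
Proof.
exists (fun j => enum_val (widen_ord hn j)) => [j k /enum_val_inj /(congr1 val) h|j].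
  exact: val_inj.
exact: enum_valP.
Qed.

Lemma leq_card_predU {T : finType} (A B : {pred T}) :
  (#|[predU A & B]| <= #|A| + #|B|)%N.
Proof. by rewrite -cardUI leq_addr. Qed.

Lemma is_copy_lt {d} {Q : porderType d} {c : coloring Q} {H : pograph} {i : 'I_2}
    {f : vertex H -> Q} (hf : is_copy c i f) (u v : vertex H) :
  edge u v -> (f u < f v)%O /\ c (f u) (f v) = i.
Proof.
case: hf => finj fle fc e; split; last exact: fc.
have /andP[vu uv] : (v != u) && (u <= v)%O by rewrite -lt_def; exact: edge_lt.
by rewrite lt_def fle // (inj_eq finj) vu.
Qed.

Section Copies.
Context {d : Order.disp_t} {Q : finPOrderType d}.
Implicit Type c : coloring Q.

Lemma has_copy_cup c i r x : (r <= #|up_nbr c i x|)%N -> has_copy c (cup r) i.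
Proof.
move=> /inj_of_card[g ginj gA].
have gP j : (x < g j)%O /\ c x (g j) = i by case/andP: (gA j) => ? /eqP.
exists (fun u : cup_vertex r => if u is CupY j then g j else x); split.
- move=> [|j] [|k] //=.
  + by move=> e; have := (gP k).1; rewrite -e ltxx.
  + by move=> e; have := (gP j).1; rewrite e ltxx.
  + by move/ginj->.
- move=> [|j] [|k] //= => [_|/eqP->//].
  exact/ltW/(gP k).1.
- move=> [|j] [|k] //= _.
  exact: (gP k).2.
Qed.

Lemma has_copy_cap c i r y : (r <= #|down_nbr c i y|)%N -> has_copy c (cap r) i.
Proof.
move=> /inj_of_card[g ginj gA].
have gP j : (g j < y)%O /\ c (g j) y = i by case/andP: (gA j) => ? /eqP.
exists (fun u : cap_vertex r => if u is CapX j then g j else y); split.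
- move=> [j|] [k|] //=.
  + by move/ginj->.
  + by move=> e; have := (gP j).1; rewrite e ltxx.
  + by move=> e; have := (gP k).1; rewrite -e ltxx.
- move=> [j|] [k|] //= => [/eqP->//|_].
  exact/ltW/(gP j).1.
- move=> [j|] [k|] //= _.
  exact: (gP j).2.
Qed.

Lemma has_copy_diamond c i s x z : (x < z)%O ->
  (s <= #|[predI up_nbr c i x & down_nbr c i z]|)%N -> has_copy c (diamond s) i.
Proof.
move=> xz /inj_of_card[g ginj gA].
have gP j : [/\ (x < g j)%O, c x (g j) = i, (g j < z)%O & c (g j) z = i].
  by case/andP: (gA j) => /andP[? /eqP ?] /andP[? /eqP ?].
exists (fun u : diamond_vertex s =>
  match u with DiaX => x | DiaY j => g j | DiaZ => z end); split.
- move=> [|j|] [|k|] //= e; try by rewrite e ltxx in xz.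
  + by have [+ _ _ _] := gP k; rewrite -e ltxx.
  + by have [+ _ _ _] := gP j; rewrite e ltxx.
  + by rewrite (ginj _ _ e).
  + by have [_ _ + _] := gP j; rewrite e ltxx.
  + by have [_ _ + _] := gP k; rewrite -e ltxx.
- move=> [|j|] [|k|] //=.
  + by have [/ltW] := gP k.
  + by rewrite (ltW xz).
  + by move/eqP->.
  + by have [_ _ /ltW] := gP j.
- move=> [|j|] [|k|] //= _.
  + by have [] := gP k.
  + by have [] := gP j.
Qed.

(** The legs of a copy are distinct and lie strictly below its top in colour [i], so a cap can be
    traded back for a count of neighbours. *)
Lemma cap_down_nbr c i r :
  has_copy c (cap r) i -> exists y, (r <= #|down_nbr c i y|)%N.
Proof.
move=> [f hf]; exists (f (CapY r)).
have fcapI : injective (fun j : 'I_r => f (CapX j)).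
  by move=> j k; case: hf => finj _ _ /finj[].
rewrite -[r in (r <= _)%N]card_ord -(card_codom fcapI).
apply/subset_leq_card/fintype.subsetP => _ /codomP[j ->].
by have [lt_fj cfj] := is_copy_lt hf (CapX j) (CapY r) isT; rewrite inE lt_fj cfj /=.
Qed.

Lemma color2E (k : 'I_2) : (k == color2) = (k != color1).
Proof. by case: k => [[|[|]]]. Qed.

(** Each comparable pair is charged to its upper end if it has colour 1, as in a cap, and to its
    lower end if it has colour 2, as in a cup. *)
Lemma card_lt_pairs c :
  (\sum_(x : Q) #|[pred y | (x < y)%O]| =
   \sum_(y : Q) #|down_nbr c color1 y| + \sum_(x : Q) #|up_nbr c color2 x|)%N.
Proof.
have -> : (\sum_(y : Q) #|down_nbr c color1 y| =
           \sum_(x : Q) #|up_nbr c color1 x|)%N.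
  under eq_bigr do rewrite -sum1_card big_mkcond /=.
  rewrite exchange_big /=; apply: eq_bigr => x _.
  by rewrite -sum1_card [RHS]big_mkcond.
rewrite -big_split /=; apply: eq_bigr => x _.
rewrite -(cardID [pred y | c x y == color1]).
by congr addn; apply: eq_card => y; rewrite !inE ?color2E andbC.
Qed.

End Copies.

Section BooleanLattice.
Import Order.DefaultSetSubsetOrder.
Variable N : nat.
Implicit Type c : coloring (boolean_lattice N).

Lemma boolean_lattice_leE (A B : boolean_lattice N) : (A <= B)%O = (A \subset B).
Proof. by []. Qed.

Lemma card_boolean_lattice : #|{: boolean_lattice N}| = (2 ^ N)%N.
Proof. by rewrite -cardsT -powersetT card_powerset cardsT card_ord. Qed.

(** Expand a product of [N] factors [2 + 1]: the term of [B] takes the 2 exactly from the factors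
    indexed by [B]. *)
Lemma sum_card_powerset : (\sum_(B : {set 'I_N}) 2 ^ #|B| = 3 ^ N)%N.
Proof.
rewrite -[N in RHS]card_ord -prod_nat_const.
rewrite (eq_bigr (fun=> 2 + 1)%N) // bigA_distr; apply: eq_bigr => B _.
by rewrite -prod_nat_const big_mkcond.
Qed.

(** The extra [2 ^ N] stands for the pairs [A = B]; the pairs [A <= B] are then counted by [B],
    which has [2 ^ #|B|] subsets. *)
Lemma card_comparable_pairs :
  (\sum_(A : boolean_lattice N) #|[pred B | (A < B)%O]| + 2 ^ N = 3 ^ N)%N.
Proof.
rewrite -sum_card_powerset.
have -> : (2 ^ N = \sum_(A : boolean_lattice N) 1)%N.
  by rewrite sum1_card card_boolean_lattice.
rewrite -big_split /=.
under [LHS]eq_bigr => A _.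
  have -> : (#|[pred B : boolean_lattice N | (A < B)%O]| + 1 =
             \sum_(B : boolean_lattice N) (A <= B)%O)%N.
    rewrite addn1 -big_mkcond sum1_card [RHS](cardD1 A).
    have -> : A \in (fun i : boolean_lattice N => (A <= i)%O) by rewrite unfold_in lexx.
    rewrite add1n; congr _.+1.
    by apply: eq_card => B; rewrite !inE lt_def.
  over.
rewrite exchange_big /=; apply: eq_bigr => B _.
rewrite -card_powerset -big_mkcond sum1_card; apply: eq_card => A.
by rewrite !inE.
Qed.

Lemma BR2_arrow_cap_cup k r : (0 < k)%N -> (1 < r)%N ->
  (2 ^ N * (k + r - 1) <= 3 ^ N)%N -> BR2_arrow (cap k) (cup r) N.
Proof.
move=> k0 r1 hN c; have r0 := ltnW r1.
have [/existsP[y hy]|/existsPn hcap] :=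
  boolP [exists y, k <= #|down_nbr c color1 y|]%N.
  by left; exact: has_copy_cap hy.
have [/existsP[x hx]|/existsPn hcup] :=
  boolP [exists x, r <= #|up_nbr c color2 x|]%N.
  by right; exact: has_copy_cup hx.
have hdown : (\sum_y #|down_nbr c color1 y| <= 2 ^ N * k.-1)%N.
  rewrite -card_boolean_lattice -sum_nat_const; apply: leq_sum => y _.
  by rewrite -ltnS prednK // ltnNge hcap.
have hup : (\sum_x #|up_nbr c color2 x| < 2 ^ N * r.-1)%N.
  (* The full set contributes 0 on the left but [r.-1], positive as [1 < r], on the right. This
     strictness is what will contradict the non-strict [hN]. *)
  rewrite -card_boolean_lattice -sum_nat_const (bigD1 [set: 'I_N]%SET) //=.
  rewrite [X in (_ < X)%N](bigD1 [set: 'I_N]%SET) //=.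
  rewrite eq_card0 => [|y]; last first.
    by rewrite inE /= le_gtF // boolean_lattice_leE finset.subsetT.
  rewrite -addSn leq_add //; first by rewrite -ltnS prednK.
  by apply: leq_sum => x _; rewrite -ltnS prednK // ltnNge hcup.
have := card_comparable_pairs; rewrite (card_lt_pairs c) => hcard.
have : (2 ^ N * (k + r - 1) < 2 ^ N * k.-1 + 2 ^ N * r.-1 + 2 ^ N)%N.
  by rewrite (leq_ltn_trans hN) // -hcard ltn_add2r -addnS leq_add.
rewrite -mulnDr -[X in (_ < _ + X)%N]muln1 -mulnDr.
suff -> : (k.-1 + r.-1 + 1 = k + r - 1)%N by rewrite ltnn.
by case: k r k0 r1 {r0 hN hcap hcup hdown hup} => [|k] [|r] // _ _;
  rewrite /= addn1 addSn addnS subn1.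
Qed.

Lemma BR2_arrow_diamond_cup {s r} : (0 < s)%N ->
  BR2_arrow (cap (s + r)) (cup r) N -> BR2_arrow (diamond s) (cup r) N.
Proof.
move=> s0 hN c; case: (hN c) => [|hcup]; last by right.
move=> /cap_down_nbr[z hz].
have [hr|hr] := leqP r #|up_nbr c color2 (finset.set0 : boolean_lattice N)|.
  by right; exact: has_copy_cup hr.
left; apply: (@has_copy_diamond _ _ c _ _ (finset.set0 : boolean_lattice N) z).
  (* The cap has a leg because [s > 0]; the empty set is weakly below that leg, hence strictly below
     [z]. *)
  have /card_gt0P[x /andP[/= xz _]] : (0 < #|down_nbr c color1 z|)%N.
    by apply: leq_trans hz; rewrite addn_gt0 s0.
  apply: le_lt_trans xz; rewrite boolean_lattice_leE; exact: finset.sub0set.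
pose bot : boolean_lattice N := finset.set0.
(* A leg other than the empty set lies above it: in colour 1 it can be a middle vertex, in colour 2
   it is among the fewer than [r] exceptions. *)
have hsub : {subset down_nbr c color1 z <=
    [predU [predI up_nbr c color1 bot & down_nbr c color1 z] &
           [predU pred1 bot & up_nbr c color2 bot]]}.
  move=> y hy; rewrite inE /= [_ \in [predI _ & _]]inE /= hy andbT !inE /=.
  have [//|ybot] := eqVneq y bot; first by rewrite orbT.
  have -> : (bot < y)%O by rewrite lt_def ybot boolean_lattice_leE finset.sub0set.
  by rewrite color2E /=; case: eqP.
move/fintype.subsetP/subset_leq_card: hsub => hsub.
(* By [hr], the empty set and the colour-2 neighbours together cost at most [r] legs, so [s] of the
   [s + r] survive. *)
rewrite -(leq_add2r r) (leq_trans hz) // (leq_trans hsub) //.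
rewrite (leq_trans (leq_card_predU _ _)) // leq_add2l.
by rewrite (leq_trans (leq_card_predU _ _)) // card1 add1n.
Qed.

End BooleanLattice.

(** The arrow property is made boolean classically, so that a least witness can be taken. *)
Lemma is_BR2_ex {G1 G2 : pograph} {N : nat} : BR2_arrow G1 G2 N ->
  exists2 m, is_BR2 G1 G2 m & (m <= N)%N.
Proof.
move=> hN; have hex : exists m, `[< BR2_arrow G1 G2 m >] by exists N; exact/asboolP.
case: (ex_minnP hex) => m /asboolP hm hmin; exists m; last exact/hmin/asboolP.
by split=> // M hM; exact/hmin/asboolP.
Qed.

(** A natural [N] is at least the base-3/2 logarithm of [m] exactly when [(3/2)^N >= m]; clear
    denominators. As [m >= 1], the logarithm is nonnegative and its ceiling is a natural number. *)
Lemma leq_exp_ceil_log (R : realType) {m : nat} : (0 < m)%N ->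
  exists2 N : nat, N%:Z = Num.ceil (ln (m%:R : R) / ln (3 / 2)) &
    (2 ^ N * m <= 3 ^ N)%N.
Proof.
move=> m0; set L := ln _ / _.
have lt1 : (1 : R) < 3 / 2 by rewrite ltr_pdivlMr ?mul1r ?ltr_nat.
have l0 : 0 < ln (3 / 2 : R) by exact: ln_gt0.
have L0 : 0 <= L by rewrite divr_ge0 ?ln_ge0 ?ler1n // ltW.
have c0 : (0 <= Num.ceil L)%R by rewrite -(ler_int R) (le_trans L0) // ceil_ge.
exists `|Num.ceil L|%N; first by rewrite gez0_abs.
set N := `|_|%N.
have : L <= N%:R by rewrite natr_absz ger0_norm ?ceil_ge.
rewrite ler_pdivrMr // [N%:R * _]mulr_natl -lnXn ?divr_gt0 //.
rewrite ler_ln ?posrE ?ltr0n // ?exprn_gt0 ?divr_gt0 //.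
rewrite expr_div_n ler_pdivlMr ?exprn_gt0 // -!natrX -natrM ler_nat.
by rewrite mulnC.
Qed.

Theorem theorem3p11 (R : realType) (s r : nat) (hs : (2 <= s)%N) (hr : (2 <= r)%N) :
  exists a b : nat,
    [/\ is_BR2 (diamond s) (cup r) a,
        is_BR2 (cap (s + r)) (cup r) b,
        (a <= b)%N &
        (b%:Z <= Num.ceil (ln (2 * r%:R + s%:R - 1 : R) / ln (3 / 2 : R)))%R].
Proof.
have s0 : (0 < s)%N by exact: ltnW.
(* This is [k + r - 1] for caps with [k = s + r] legs; positivity also makes the truncated
   subtraction agree with the real one. *)
have pos : (0 < s + r + r - 1)%N by rewrite subn_gt0 -addnA ltn_addr.
have [N ceilN hN] := leq_exp_ceil_log R pos.
have hcap : BR2_arrow (cap (s + r)) (cup r) N.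
  by apply: BR2_arrow_cap_cup; rewrite ?addn_gt0 ?s0.
have [b hb bN] := is_BR2_ex hcap.
(* The transfer to diamonds is applied at the minimal [b] rather than at [N], which yields
   [a <= b]. *)
have [a ha ab] := is_BR2_ex (BR2_arrow_diamond_cup b s0 hb.1).
exists a, b; split => //.
have -> : 2 * r%:R + s%:R - 1 = (s + r + r - 1)%:R :> R.
  rewrite natrB; last by rewrite ltnW // -subn_gt0.
  by rewrite !natrD mulr_natl mulr2n [_ + _ + s%:R]addrC addrA.
by rewrite -ceilN lez_nat.
Qed.
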